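(* Let $X$ be a homogeneously self-similar graph of bounded geometry, with length scaling factor $\nu$ and volume scaling factor $\mu$. Then the lower and upper global growth dimensions of $X$ are $$\underline{\dim}_G X=\overline{\dim}_G X=\frac{\log\mu}{\log\nu}.$$
   Context: Graph $X$ with vertex set $VX$ and edge set $EX$ is connected, locally finite, infinite, without loops or multiple edges. $d_X$ is the graph distance (length of a shortest path) and $\deg_X x$ the number of neighbours of $x$ in $X$. For $C\subset VX$, the boundary $\theta C$ is the set of vertices in $VX\setminus C$ adjacent to some vertex of $C$; the closure is $\overline{C}=C\cup\theta C$; $\hat C$ is the subgraph of $X$ spanned (induced) by $\overline{C}$. For $F\subset VX$, $\mathcal{C}_XF$ denotes the set of connected components of $VX\setminus F$ (as vertex sets). The reduced graph $X_F$ has vertex set $F$, and two (distinct) vertices $x,y\in F$ are adjacent in $X_F$ iff there is $C\in\mathcal{C}_XF$ with $x,y\in\theta C$. $X$ is self-similar with respect to $F\subset VX$ and $\psi:VX\to F$ if: (F1) no two vertices of $F$ are adjacent in $X$; (F2) the intersection of the closures of two different components in $\mathcal{C}_XF$ contains at most one vertex; (F3) $\psi$ is a graph isomorphism from $X$ to $X_F$. Put $F^0=VX$, $F^n=\psi^n(VX)$ (so $F^1=F$). Elements of $\mathcal{C}_XF^n$ are called $n$-cells; $1$-cells are called cells. A self-similar graph $X$ is homogeneously self-similar if: (H1) all cell graphs $\hat C$ ($C\in\mathcal{C}_XF$) are finite and for any cells $C,D$ there is a graph isomorphism $\alpha:\hat C\to\hat D$ with $\alpha(\theta C)=\theta D$;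 (H2) for every cell $C$ and $v_1,v_2,v_3,v_4\in\theta C$ with $v_1\neq v_2$, $v_3\ne v_4$, one has $d_X(v_1,v_2)=d_X(v_3,v_4)$. The length scaling factor $\nu$ is the $d_X$-distance of two different vertices in the boundary of a cell; the volume scaling factor $\mu$ is the number of cells contained in a $2$-cell (these do not depend on the choices). $X$ has bounded geometry if the set of its vertex degrees is bounded. Growth: $B(x,r)=\{y\in VX: d_X(y,x)\le r\}$ for $x\in VX$, $r\in\mathbb{N}_0$; for $A\subset VX$, $\mathrm{Vol}_X A=\sum_{y\in A}\deg_X y$; $V_x(r)=\mathrm{Vol}_X B(x,r)$; $\underline{V}(r)=\inf\{V_x(r): x\in VX\}$, $\overline{V}(r)=\sup\{V_x(r): x\in VX\}$. The global growth dimensions are $$\underline{\dim}_GX=\liminf_{r\to\infty}\frac{\log\underline{V}(r)}{\log r},\qquad \overline{\dim}_GX=\limsup_{r\to\infty}\frac{\log\overline{V}(r)}{\log r}.$$ *)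

(* Defs.v *)
From HB Require Import structures.
From mathcomp Require Import all_boot all_order all_algebra.
From mathcomp Require Import finmap.
From mathcomp Require Import all_classical all_reals all_analysis.

Set Implicit Arguments.
Unset Strict Implicit.
Unset Printing Implicit Defensive.

Import Order.TTheory GRing.Theory Num.Theory.

Local Open Scope classical_set_scope.

Record sgraph := SGraph {
  vert :> choiceType;
  adj : rel vert;
  adj_sym : symmetric adj;
  adj_irr : irreflexive adj }.

Definition graph_iso (G H : sgraph) (f : G -> H) : Prop :=
  bijective f /\ forall x y : G, adj (f x) (f y) = adj x y.

Section Subgraph.
Variables (X : sgraph) (A : set X).

Definition induced_adj : rel A := fun x y => adj (val x) (val y).

Lemma induced_adj_sym : symmetric induced_adj.
Proof. by move=> x y; exact: adj_sym. Qed.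

Lemma induced_adj_irr : irreflexive induced_adj.
Proof. by move=> x; exact: adj_irr. Qed.

Definition induced : sgraph := SGraph induced_adj_sym induced_adj_irr.

End Subgraph.

Section Metric.
Variable X : sgraph.

Definition nbrs (x : X) : set X := [set y | adj x y].

Definition locally_finite : Prop := forall x : X, finite_set (nbrs x).

(* The value is meaningful when [nbrs x] is finite: [fset_set] sends infinite
   sets to the empty one. *)
Definition deg (x : X) : nat := #|` fset_set (nbrs x)|.

Definition bounded_geometry : Prop :=
  exists M : nat, forall x : X, (deg x <= M)%N.

Definition has_walk (x y : X) (n : nat) : Prop :=
  exists p : seq X, [/\ path (@adj X) x p, last x p = y & size p = n].

Definition connected_graph : Prop := forall x y : X, exists n, has_walk x y n.

(* The value 0 is a placeholder for vertices in different components. *)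
Definition gdist (x y : X) : nat :=
  if pselect (exists n, `[< has_walk x y n >]) is left h then ex_minn h else 0%N.

Definition gball (x : X) (r : nat) : set X := [set y | (gdist y x <= r)%N].

Definition bdry (C : set X) : set X :=
  [set y | ~ C y /\ exists2 x, C x & adj x y].

Definition gclosure (C : set X) : set X := C `|` bdry C.

Definition hull (C : set X) : sgraph := induced (gclosure C).

Definition walk_within (A : set X) (x y : X) : Prop :=
  exists p : seq X, [/\ path (@adj X) x p, last x p = y &
    forall z, z \in x :: p -> A z].

Definition components (A : set X) : set (set X) :=
  [set C | exists2 x, A x & C = walk_within A x].

(* The components of the complement of F. *)
Definition cells (F : set X) : set (set X) := components (~` F).

End Metric.

Section Reduced.
Variables (X : sgraph) (F : set X).

Definition reduced_adj : rel F := fun x y =>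
  (x != y) && `[< exists2 C, cells F C & bdry C (val x) /\ bdry C (val y) >].

Lemma reduced_adj_sym : symmetric reduced_adj.
Proof.
move=> x y; rewrite /reduced_adj eq_sym; congr (_ && _).
by apply/asboolP/asboolP => -[C FC [Cx Cy]]; exists C.
Qed.

Lemma reduced_adj_irr : irreflexive reduced_adj.
Proof. by move=> x; rewrite /reduced_adj eqxx. Qed.

Definition reduced : sgraph := SGraph reduced_adj_sym reduced_adj_irr.

End Reduced.

Section SelfSimilar.
Variables (X : sgraph) (F : set X) (psi : X -> reduced F).

Record self_similar : Prop := {
  ss_independent : forall x y, F x -> F y -> ~~ adj x y;
  ss_closures : forall C D, cells F C -> cells F D -> C <> D ->
    is_subset1 (gclosure C `&` gclosure D);
  ss_iso : graph_iso psi }.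

Definition iterF (n : nat) : set X := range (iter n (fun x => val (psi x))).

Definition ncells (n : nat) : set (set X) := cells (iterF n).

Record homogeneously_self_similar : Prop := {
  hss_self_similar : self_similar;
  hss_finite : forall C, cells F C -> finite_set (gclosure C);
  hss_iso : forall C D, cells F C -> cells F D ->
    exists2 alpha : hull C -> hull D, graph_iso alpha &
      [set val (alpha u) | u in [set u | bdry C (val u)]] = bdry D;
  hss_dist : forall C v1 v2 v3 v4, cells F C ->
    bdry C v1 -> bdry C v2 -> bdry C v3 -> bdry C v4 ->
    v1 <> v2 -> v3 <> v4 -> gdist v1 v2 = gdist v3 v4 }.

(* Neither scaling factor depends on the chosen cell when psi makes X
   homogeneously self-similar, so both are specified by an arbitrary choice. *)
Definition length_scaling (nu : nat) : Prop :=
  exists C v1 v2,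
    [/\ cells F C, bdry C v1, bdry C v2, v1 <> v2 & gdist v1 v2 = nu].

Definition volume_scaling (mu : nat) : Prop :=
  exists2 D, ncells 2 D &
    ([set C | cells F C /\ C `<=` D] #= `I_mu)%card.

End SelfSimilar.

Section Growth.
Variables (R : realType) (X : sgraph).

Local Open Scope ring_scope.
Local Open Scope ereal_scope.

Definition vol (A : set X) : \bar R := \esum_(y in A) ((deg y)%:R)%:E.

Definition inf_vol (r : nat) : \bar R := ereal_inf [set vol (gball x r) | x in [set: X]].
Definition sup_vol (r : nat) : \bar R := ereal_sup [set vol (gball x r) | x in [set: X]].

Definition lower_growth_dim : \bar R :=
  limn_einf (fun r : nat => lne (inf_vol r) / (ln (r%:R : R))%:E).

Definition upper_growth_dim : \bar R :=
  limn_esup (fun r : nat => lne (sup_vol r) / (ln (r%:R : R))%:E).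

End Growth.

(* Main.v *)
Require Import Defs.
From HB Require Import structures.
From mathcomp Require Import all_boot all_order all_algebra.
From mathcomp Require Import finmap zify ring lra.
From mathcomp Require Import all_classical all_reals all_analysis.

Set Implicit Arguments.
Unset Strict Implicit.
Unset Printing Implicit Defensive.

Import Order.TTheory GRing.Theory Num.Theory.
Import numFieldNormedType.Exports.

Local Open Scope classical_set_scope.

(** Write f for psi seen as a map X -> X.  Pulling the boundary of a cell C back
    along f gives a clique of X, and by (F2) and (F3) these cliques partition the
    edges of X.  Each clique lies in the closure of exactly one cell, the parent
    of C; counting the edges of a hull shows that all cells have equally many
    children, and this number is mu.  Moreover d(f x, f y) = nu d(x, y), and
    cell closures have diameter at most some k.  Hence the number N(x, r) of cells
    whose clique meets B(x, r), which is comparable to the volume of B(x, r), satisfies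
    N(y, nu r + 2k) >= mu N(x, r) and N(y, nu r - 2k) <= mu N(x, r)
    whenever d(y, f x) <= k, and every y is that close to some f x.  Iterating,
    V_x(nu^n) is of order mu^n uniformly in x. *)

(** * Cardinalities of finite sets *)

Section Counting.

(* Junk value 0 on infinite sets. *)
Definition ncard (T : choiceType) (A : set T) : nat := #|` fset_set A|.

Lemma ncard_inj (T1 T2 : choiceType) (A : set T1) (B : set T2) (g : T1 -> T2) :
  finite_set A -> finite_set B -> (forall x, A x -> B (g x)) ->
  (forall x y, A x -> A y -> g x = g y -> x = y) -> (ncard A <= ncard B)%N.
Proof.
move=> finA finB gAB ginj; rewrite /ncard.
have -> : #|` fset_set A| = #|` [fset g x | x in fset_set A]%fset|.
  apply/esym/card_in_imfset => x y /=.
  by rewrite !in_fset_set// !inE => Ax Ay; apply: ginj.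
apply/fsubset_leq_card/fsubsetP => y /imfsetP[x /= + ->].
by rewrite !in_fset_set// !inE; apply: gAB.
Qed.

Lemma ncard_sub (T : choiceType) (A B : set T) :
  finite_set B -> A `<=` B -> (ncard A <= ncard B)%N.
Proof.
move=> finB AB; apply: (@ncard_inj _ _ A B id) => //.
exact: sub_finite_set finB.
Qed.

Lemma ncard_gt0 (T : choiceType) (A : set T) (x : T) :
  finite_set A -> A x -> (0 < ncard A)%N.
Proof.
move=> finA Ax; rewrite /ncard cardfs_gt0; apply/fset0Pn.
by exists x; rewrite in_fset_set// inE.
Qed.

(** Double counting: write each fiber as a sum of ones over [S] and exchange the sums; every [x] is
    then counted once, at [y = g x]. *)
Lemma ncard_fibers (T1 T2 : choiceType) (S : set T1) (Q : set T2) (g : T1 -> T2) :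
  finite_set S -> finite_set Q -> (forall x, S x -> Q (g x)) ->
  ncard S = (\sum_(y <- fset_set Q) ncard [set x | S x /\ g x = y])%N.
Proof.
move=> finS finQ gSQ.
have fibE y : ncard [set x | S x /\ g x = y] =
    (\sum_(i <- fset_set S | g i == y) 1)%N.
  rewrite /ncard card_fset_sum1.
  have -> : fset_set [set x | S x /\ g x = y] =
      [fset x in fset_set S | g x == y]%fset.
    apply/fsetP => x; rewrite in_fset_set ?inE /=.
      rewrite in_fset_set//; apply/idP/andP.
        by rewrite inE => -[Sx /eqP]; rewrite inE.
      by rewrite !inE => -[Sx /eqP].
    by apply: sub_finite_set finS => z [].
  by rewrite [RHS]big_fset_condE.
rewrite (eq_bigr _ (fun y _ => fibE y)) (exchange_big_dep predT)//=.
rewrite /ncard card_fset_sum1 big_seq [RHS]big_seq; apply: eq_bigr => x.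
rewrite in_fset_set// inE => Sx; rewrite (eq_bigl (pred1 (g x))) => [|y].
  by rewrite sum1_count count_uniq_mem// in_fset_set// mem_set//; apply: gSQ.
by rewrite /= eq_sym.
Qed.

Lemma ncard_fibers_le (T1 T2 : choiceType) (S : set T1) (Q : set T2)
    (g : T1 -> T2) (b : nat) :
  finite_set S -> finite_set Q -> (forall x, S x -> Q (g x)) ->
  (forall y, Q y -> ncard [set x | S x /\ g x = y] <= b)%N ->
  (ncard S <= b * ncard Q)%N.
Proof.
move=> finS finQ gSQ fib; rewrite (ncard_fibers finS finQ gSQ).
rewrite {2}/ncard card_fset_sum1 big_distrr /= big_seq [leqRHS]big_seq.
apply: leq_sum => y; rewrite in_fset_set// inE => Qy.
by rewrite muln1; apply: fib.
Qed.

Lemma ncard_fibers_ge (T1 T2 : choiceType) (S : set T1) (Q : set T2)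
    (g : T1 -> T2) (b : nat) :
  finite_set S -> finite_set Q -> (forall x, S x -> Q (g x)) ->
  (forall y, Q y -> b <= ncard [set x | S x /\ g x = y])%N ->
  (b * ncard Q <= ncard S)%N.
Proof.
move=> finS finQ gSQ fib; rewrite (ncard_fibers finS finQ gSQ).
rewrite {1}/ncard card_fset_sum1 big_distrr /= big_seq [leqRHS]big_seq.
apply: leq_sum => y; rewrite in_fset_set// inE => Qy.
by rewrite muln1; apply: fib.
Qed.

Lemma ncard_image (T1 T2 : choiceType) (A : set T1) (g : T1 -> T2) :
  finite_set A -> (ncard (g @` A) <= ncard A)%N.
Proof.
move=> finA; rewrite -[leqLHS]mul1n.
apply: (@ncard_fibers_ge _ _ _ _ g) => //; first exact: finite_image.
move=> _ [x Ax <-]; apply: (@ncard_gt0 _ _ x); last by [].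
by apply: sub_finite_set finA => z [].
Qed.

Lemma ncard_setU (T : choiceType) (A B : set T) : finite_set A -> finite_set B ->
  (ncard (A `|` B) <= ncard A + ncard B)%N.
Proof.
by move=> finA finB; rewrite /ncard fset_setU// cardfsU leq_subr.
Qed.

End Counting.

(** * Walks, distances and components *)

Section Walks.
Variable X : sgraph.
Implicit Types (x y z : X) (p q : seq X) (A C D : set X).

Lemma gdist_le x p : path (@adj X) x p -> (gdist x (last x p) <= size p)%N.
Proof.
move=> xp; rewrite /gdist; case: pselect => // h; case: ex_minnP => n _; apply.
by apply/asboolP; exists p.
Qed.

Lemma gdistxx x : gdist x x = 0%N.
Proof. by have := @gdist_le x [::] isT; rewrite leqn0 => /eqP. Qed.

Lemma path_rev x p : path (@adj X) x p ->
  path (@adj X) (last x p) (rev (belast x p)) /\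
  last (last x p) (rev (belast x p)) = x.
Proof.
move=> xp; split; last by case: p {xp} => //= a p; rewrite rev_cons last_rcons.
by rewrite rev_path; apply: sub_path xp => u v; rewrite adj_sym.
Qed.

Hypothesis X_conn : connected_graph X.

Lemma gdist_walk x y :
  exists p, [/\ path (@adj X) x p, last x p = y & size p = gdist x y].
Proof.
rewrite /gdist; case: pselect => [h|[]]; last first.
  by have [n xyn] := X_conn x y; exists n; apply/asboolP.
by case: ex_minnP => n /asboolP[p [? ? ?]] _; exists p.
Qed.

Lemma gdist_symle x y : (gdist x y <= gdist y x)%N.
Proof.
have [p [yp <- <-]] := gdist_walk y x; have [rp {2}<-] := path_rev yp.
by rewrite -(size_belast y p) -size_rev; apply: gdist_le.
Qed.

Lemma gdistC x y : gdist x y = gdist y x.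
Proof. by apply/eqP; rewrite eqn_leq !gdist_symle. Qed.

Lemma gdist_triangle x y z : (gdist x z <= gdist x y + gdist y z)%N.
Proof.
have [p [xp py <-]] := gdist_walk x y; have [q [yq qz <-]] := gdist_walk y z.
rewrite -size_cat -qz -py -last_cat; apply: gdist_le.
by rewrite cat_path xp py.
Qed.

Lemma gdist_finite_within A x y : finite_set A -> walk_within A x y ->
  (gdist x y <= ncard A)%N.
Proof.
(* A duplicate-free shortening of the walk has [size q + 1] distinct vertices, all in [A]. *)
move=> finA [p [xp <- pA]]; case/shortenP: xp pA => q xq uq qp pA.
apply: leq_trans (gdist_le xq) _; apply: leq_trans (leqnSn _) _.
rewrite -[_.+1]/(size (x :: q)) -[in leqLHS](undup_id uq) -card_fseq.
apply/fsubset_leq_card/fsubsetP => z; rewrite in_fset_set// !inE => /orP[/eqP->|].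
  by apply: pA; rewrite mem_head.
by move=> /qp zp; apply: pA; rewrite inE zp orbT.
Qed.

Lemma walk_within_sym A x y : walk_within A x y -> walk_within A y x.
Proof.
move=> [p [xp <- pA]]; have [rp rl] := path_rev xp.
exists (rev (belast x p)); split => // z; rewrite inE mem_rev => zp; apply: pA.
by rewrite lastI mem_rcons inE.
Qed.

Lemma walk_within_trans A x y z :
  walk_within A x y -> walk_within A y z -> walk_within A x z.
Proof.
move=> [p [xp py pA]] [q [yq qz qA]]; exists (p ++ q); split.
- by rewrite cat_path xp py.
- by rewrite last_cat py.
- move=> w; rewrite -cat_cons mem_cat => /orP[/pA//|wq].
  by apply: qA; rewrite inE wq orbT.
Qed.

Lemma walk_within_sub A B x y : A `<=` B -> walk_within A x y -> walk_within B x y.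
Proof. by move=> AB [p [xp py pA]]; exists p; split => // z /pA/AB. Qed.

Lemma walk_within_refl A x : A x -> walk_within A x x.
Proof. by move=> Ax; exists [::]; split => // z; rewrite inE => /eqP->. Qed.

Lemma walk_within_adj A x y : A x -> A y -> adj x y -> walk_within A x y.
Proof.
move=> Ax Ay xy; exists [:: y]; split; rewrite /= ?xy// => z.
by rewrite !inE => /orP[] /eqP->.
Qed.

Lemma component_of A x : A x -> components A (walk_within A x).
Proof. by exists x. Qed.

Lemma component_sub A C : components A C -> C `<=` A.
Proof. by move=> [x Ax ->] y [p [_ <-]]; apply; exact: mem_last. Qed.

Lemma component_walk A C x y : components A C -> C x -> C y -> walk_within A x y.
Proof.
move=> [c Ac ->] /walk_within_sym xc; exact: walk_within_trans.
Qed.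

Lemma component_absorb A C x y : components A C -> C x -> walk_within A x y -> C y.
Proof. by move=> [c Ac ->] cx xy; apply: walk_within_trans cx xy. Qed.

Lemma component_adj A C x y : components A C -> C x -> adj x y -> A y -> C y.
Proof.
move=> hC Cx xy Ay; apply: (component_absorb hC Cx _).
exact: walk_within_adj (component_sub hC Cx) Ay xy.
Qed.

Lemma component_path A C x p : components A C -> C x -> path (@adj X) x p ->
  (forall z, z \in p -> A z) -> forall z, z \in x :: p -> C z.
Proof.
move=> hC; elim: p x => [x Cx _ _ z|y p IH x Cx /= /andP[xy yp] pA z].
  by rewrite inE => /eqP->.
rewrite inE => /orP[/eqP->//|]; apply: IH => //; last first.
  by move=> w wp; apply: pA; rewrite inE wp orbT.
by apply: (component_adj hC Cx xy); apply: pA; rewrite mem_head.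
Qed.

Lemma component_walk_in A C x y : components A C -> C x -> C y -> walk_within C x y.
Proof.
move=> hC Cx Cy; have [p [xp py pA]] := component_walk hC Cx Cy.
exists p; split => //; apply: (component_path hC Cx xp) => z zp.
by apply: pA; rewrite inE zp orbT.
Qed.

End Walks.

(** * Cells *)

Definition subst_map (X : sgraph) (F : set X) (psi : X -> reduced F) (x : X) : X :=
  val (psi x).

Section Cells.
Variables (X : sgraph) (F : set X) (psi : X -> reduced F).
Hypothesis X_conn : connected_graph X.
Hypothesis X_hss : homogeneously_self_similar psi.
Implicit Types (x y z v w : X) (C D P : set X).

Local Notation f := (subst_map psi).
Local Notation cell := (cells F).

Let X_ss := hss_self_similar X_hss.

Lemma subst_in x : F (f x).
Proof. exact: set_mem (valP (psi x)). Qed.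

Lemma subst_inj : injective f.
Proof. by move=> x y /val_inj; apply: bij_inj (ss_iso X_ss).1 _ _. Qed.

Lemma subst_surj v : F v -> exists x, f x = v.
Proof.
move=> Fv; have [g _ gK] := (ss_iso X_ss).1.
by exists (g (SigSub (mem_set Fv))); rewrite /subst_map gK.
Qed.

(** This is (F3), with adjacency in the reduced graph unfolded. *)
Lemma subst_adj x y :
  adj x y <-> x <> y /\ exists2 C, cell C & bdry C (f x) /\ bdry C (f y).
Proof.
rewrite -((ss_iso X_ss).2 x y) /= /reduced_adj; split.
  by move=> /andP[/eqP xy /asboolP H]; split => // exy; apply: xy; rewrite exy.
move=> [xy H]; apply/andP; split; last exact/asboolP.
by apply/eqP => exy; apply: xy; apply: subst_inj; rewrite /subst_map exy.
Qed.

Lemma cell_eq C D v w : cell C -> cell D -> v <> w ->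
  gclosure C v -> gclosure C w -> gclosure D v -> gclosure D w -> C = D.
Proof.
move=> hC hD vw Cv Cw Dv Dw; apply: contrapT => CD.
by apply: vw; apply: (ss_closures X_ss hC hD CD); split.
Qed.

Lemma bdry_F C v : cell C -> bdry C v -> F v.
Proof.
move=> hC [nCv [x Cx xv]]; apply: contrapT => nFv; apply: nCv.
exact: component_adj hC Cx xv nFv.
Qed.

Lemma cell_notF C x : cell C -> C x -> ~ F x.
Proof. by move=> hC; apply: component_sub hC x. Qed.

Lemma bdry_mem C x v : cell C -> C x -> adj x v -> F v -> bdry C v.
Proof. by move=> hC Cx xv Fv; split; [move=> /(cell_notF hC)|exists x]. Qed.

Lemma closure_adj C x y : cell C -> C x -> adj x y -> gclosure C y.
Proof.
move=> hC Cx xy; have [Fy|nFy] := pselect (F y).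
  by right; apply: bdry_mem hC Cx xy Fy.
by left; apply: component_adj hC Cx xy nFy.
Qed.

(** Each vertex of the closure is in [C] or one edge away from it, and [C] is connected. *)
Lemma closure_walk C x y : cell C -> gclosure C x -> gclosure C y ->
  walk_within (gclosure C) x y.
Proof.
move=> hC.
have to_cell z : gclosure C z -> exists2 c, C c & walk_within (gclosure C) c z.
  move=> [Cz|Cz]; first by exists z => //; apply: walk_within_refl; left.
  have [_ [c Cc cz]] := Cz; exists c => //.
  by apply: walk_within_adj cz; [left|right].
move=> /to_cell[c Cc cx] /to_cell[d Cd dy].
apply: walk_within_trans (walk_within_sym cx) _.
apply: walk_within_trans dy.
by apply: (walk_within_sub _ (component_walk_in hC Cc Cd)) => z; left.
Qed.

(** The isomorphism of (H1), extended to a total map on [X] so that later arguments avoid sigma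
    types. Off the closure of [C] it is the identity, a junk value. *)
Lemma hull_map C D : cell C -> cell D -> exists a : X -> X,
  [/\ forall x, gclosure C x -> gclosure D (a x),
      forall x, bdry C x -> bdry D (a x),
      forall x y, gclosure C x -> gclosure C y -> a x = a y -> x = y &
      forall x y, gclosure C x -> gclosure C y -> adj (a x) (a y) = adj x y].
Proof.
move=> hC hD; have [al [al_bij al_adj] al_bdry] := hss_iso X_hss hC hD.
pose a x := if pselect (gclosure C x) is left h
  then val (al (SigSub (mem_set h))) else x.
have aE x (h : gclosure C x) : a x = val (al (SigSub (mem_set h))).
  by rewrite /a; case: pselect => // h'; rewrite (Prop_irrelevance h' h).
exists a; split.
- by move=> x Cx; rewrite aE; apply: set_mem (valP _).
- move=> x Cx; rewrite aE; first by right.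
  by move=> h; rewrite -al_bdry; exists (SigSub (mem_set h)).
- move=> x y Cx Cy; rewrite !aE => /val_inj /(bij_inj al_bij).
  by move=> /(congr1 val).
- by move=> x y Cx Cy; rewrite !aE; apply: al_adj.
Qed.

(** By (F1) the walk leaves [F] with its first step. Until its first return [w] to [F] it stays in
    the component of that second vertex, so [a] and [w] both bound this component. They may
    coincide. *)
Lemma cell_first_hit a p : path (@adj X) a p -> F a -> F (last a p) ->
  p <> [::] -> exists s w t C,
  [/\ p = s ++ w :: t, s <> [::], cell C, bdry C a /\ bdry C w &
      forall z, z \in s -> C z].
Proof.
case: p => // c p /= /andP[ac cp] Fa Fl _.
have nFc : ~ F c by move=> Fc; have := ss_independent X_ss Fa Fc; rewrite ac.
have : has (mem F) p.
  case/lastP: p cp Fl => [|p l] cp; rewrite ?last_rcons // => Fl.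
  by rewrite has_rcons /= mem_set.
move=> hp; have [s [w [t [ep Fw /hasPn nFs]]]] : exists s w t,
    [/\ p = rcons s w ++ t, mem F w & ~~ has (mem F) s].
  exists (take (find (mem F) p) p), (nth a p (find (mem F) p)),
    (drop (find (mem F) p).+1 p).
  by case: (split_find_nth a hp) => w s t Fw nFs; split.
exists (c :: s), w, t, (walk_within (~` F) c).
have hC : cell (walk_within (~` F) c) by exact: component_of.
have Cc : walk_within (~` F) c c by apply: walk_within_refl.
move: cp; rewrite ep cat_path rcons_path => /andP[/andP[cs sw] _].
have Cs : forall z, z \in c :: s -> walk_within (~` F) c z.
  apply: (component_path hC Cc cs) => z /nFs /negP nFz Fz.
  by apply: nFz; rewrite /= mem_set.
split => //; first by rewrite -cats1 -catA.
have {}Fw : F w by exact: set_mem Fw.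
split; first by apply: bdry_mem hC Cc _ Fa; rewrite adj_sym.
by apply: bdry_mem hC _ sw Fw; apply: Cs; apply: mem_last.
Qed.

(** * Boundary distances and the scaling of f *)

Variable nu : nat.
Hypothesis X_nu : length_scaling F nu.

Lemma cell_bdry2 C : cell C -> exists v w, [/\ bdry C v, bdry C w & v <> w].
Proof.
move=> hC; have [D [v [w [hD Dv Dw vw _]]]] := X_nu.
have [a [_ abdry ainj _]] := hull_map hD hC.
exists (a v), (a w); split; [exact: abdry|exact: abdry|move=> /ainj vw'].
by apply: vw; apply: vw'; right.
Qed.

(* A pair of boundary vertices of minimal distance over all cells is joined by
   a geodesic inside a single hull, which (H1) copies into every other cell. *)
Lemma cell_bdry_dist C v w : cell C -> bdry C v -> bdry C w -> v <> w ->
  gdist v w = nu.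
Proof.
pose Pm m := exists D v w, [/\ cell D, bdry D v, bdry D w, v <> w & gdist v w = m].
have exP : exists m, `[< Pm m >].
  by exists nu; apply/asboolP; have [D [x [y []]]] := X_nu; exists D, x, y.
case: (ex_minnP exP) => m /asboolP[C0 [v0 [w0 [hC0 Cv0 Cw0 vw0 dm]]]] m_min.
have {}m_min D x y : cell D -> bdry D x -> bdry D y -> x <> y -> (m <= gdist x y)%N.
  by move=> hD Dx Dy xy; apply: m_min; apply/asboolP; exists D, x, y.
have [p [vp pw sz]] := gdist_walk X_conn v0 w0.
have p0 : p <> [::] by move=> p0; apply: vw0; rewrite -pw p0.
have Fw0 : F (last v0 p) by rewrite pw; apply: bdry_F hC0 Cw0.
have [s [u [t [C1 [ep s0 hC1 [C1v C1u] C1s]]]]] :=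
  cell_first_hit vp (bdry_F hC0 Cv0) Fw0 p0.
move: vp; rewrite ep cat_path /= => /and3P[vs su ut].
have lut : last u t = w0 by rewrite -pw ep last_cat.
(* Otherwise [t] alone would be a shorter walk from [v0] to [w0]. *)
have vu : v0 <> u.
  move=> vu; have := gdist_le ut; rewrite lut -vu -sz ep size_cat /=; lia.
(* The first segment joins distinct boundary vertices of [C1], so by minimality it already has
   length at least [m], the length of the whole geodesic. *)
have t0 : t = [::].
  have := m_min _ _ _ hC1 C1v C1u vu.
  have : (gdist v0 u <= size (rcons s u))%N.
    by rewrite -{1}(last_rcons v0 s u); apply: gdist_le; rewrite rcons_path vs.
  rewrite size_rcons -dm -sz ep size_cat /=.
  by case: (t) => //= *; lia.
have uw : u = w0 by rewrite -lut t0.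
have C10 : C1 = C0.
  by apply: (cell_eq hC1 hC0 vw0); rewrite -?uw; right=> //; rewrite uw.
have pC z : z \in v0 :: p -> gclosure C0 z.
  rewrite ep t0 inE mem_cat mem_seq1 => /or3P[/eqP->|/C1s|/eqP->].
  - by right.
  - by rewrite C10; left.
  - by right; rewrite uw.
(* The copied geodesic gives one boundary pair of [D] at distance at most [m], hence exactly [m];
   (H2) passes this on to all pairs of [D]. *)
have dist_m D x y : cell D -> bdry D x -> bdry D y -> x <> y -> gdist x y = m.
  move=> hD Dx Dy xy; have [a [_ abdry ainj aadj]] := hull_map hC0 hD.
  have avw : a v0 <> a w0 by move=> /ainj h; apply: vw0; apply: h; right.
  rewrite (hss_dist X_hss hD Dx Dy (abdry _ Cv0) (abdry _ Cw0) xy avw).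
  apply/eqP; rewrite eqn_leq (m_min _ _ _ hD (abdry _ Cv0) (abdry _ Cw0) avw) andbT.
  rewrite -dm -sz -(size_map a p) -pw -last_map; apply: gdist_le.
  have vp : path (@adj X) v0 p by rewrite ep cat_path /= vs su.
  elim: (p) (v0) vp pC => //= b q IH b0 /andP[bb bq] qC.
  rewrite aadj ?bb//=; last 2 first.
  - by apply: qC; rewrite mem_head.
  - by apply: qC; rewrite !inE eqxx orbT.
  by apply: IH => // z zq; apply: qC; rewrite inE zq orbT.
move=> hC Cv Cw vw; have [D [x [y [hD Dx Dy xy <-]]]] := X_nu.
by rewrite (dist_m _ _ _ hD Dx Dy xy); apply: dist_m hC Cv Cw vw.
Qed.

(** Boundary vertices lie in [F], and by (F1) a walk between two of them visits a vertex off [F] in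
    between. *)
Lemma length_scaling_gt1 : (1 < nu)%N.
Proof.
have [D [x [y [hD Dx Dy xy <-]]]] := X_nu.
have [p [vp pw <-]] := gdist_walk X_conn x y.
have p0 : p <> [::] by move=> p0; apply: xy; rewrite -pw p0.
have Fl : F (last x p) by rewrite pw; apply: bdry_F hD Dy.
have [[|c s] [u [t [C [-> s0 _ _ _]]]]] := cell_first_hit vp (bdry_F hD Dx) Fl p0 => //.
by rewrite /= size_cat /=; lia.
Qed.

Lemma subst_adj_dist x y : adj x y -> gdist (f x) (f y) = nu.
Proof.
move=> /subst_adj[xy [C hC [Cx Cy]]]; apply: cell_bdry_dist hC Cx Cy _.
by move=> /subst_inj.
Qed.

Lemma subst_walk_lift x y p : path (@adj X) (f x) p -> last (f x) p = f y ->
  exists q, [/\ path (@adj X) x q, last x q = y, (nu * size q <= size p)%N &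
    forall z, z \in q -> f z \in p].
Proof.
have [n] := ubnP (size p); elim: n x p => // n IH x p szn xp py.
have [p0|p0] := pselect (p = [::]).
  by exists [::]; split=> //=; [apply: subst_inj; rewrite -py p0|rewrite muln0].
have Fl : F (last (f x) p) by rewrite py; apply: subst_in.
have [s [w [t [C [ep s0 hC [Cx Cw] Cs]]]]] := cell_first_hit xp (subst_in x) Fl p0.
have [u uw] := subst_surj (bdry_F hC Cw).
move: xp py szn; rewrite ep cat_path last_cat size_cat -uw /=.
move=> /and3P[xs su ut] lu szn.
have [|q [uq qy szq qt]] := IH u t _ ut lu; first lia.
(* A segment that returns to its start [f x] yields no edge and is dropped. *)
have [xu|xu] := pselect (x = u).
  exists q; rewrite xu; split=> // [|z /qt zt]; first lia.
  by rewrite mem_cat inE zt !orbT.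
exists (u :: q); split=> //=.
- by rewrite uq andbT; apply/subst_adj; split=> //; exists C => //; rewrite uw.
- have : (gdist (f x) (f u) <= size (rcons s (f u)))%N.
    rewrite -{1}(last_rcons (f x) s (f u)); apply: gdist_le.
    by rewrite rcons_path xs.
  rewrite (cell_bdry_dist hC) ?uw// ?size_rcons -?uw; last by move=> /subst_inj.
  by move=> h; rewrite mulnS; lia.
- move=> z; rewrite inE mem_cat inE => /orP[/eqP->|/qt->]; rewrite ?eqxx ?orbT//.
Qed.

(** For the upper bound a geodesic is mapped edge by edge; for the lower bound a geodesic between
    the images is lifted. *)
Lemma subst_dist x y : gdist (f x) (f y) = (nu * gdist x y)%N.
Proof.
apply/eqP; rewrite eqn_leq; apply/andP; split.
  have [p [xp <- <-]] := gdist_walk X_conn x y.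
  elim: p x xp => /= [x _|z p IH x /andP[xz zp]]; first by rewrite gdistxx.
  apply: leq_trans (gdist_triangle X_conn _ (f z) _) _.
  by rewrite (subst_adj_dist xz) mulnS leq_add2l; apply: IH.
have [p [xp py <-]] := gdist_walk X_conn (f x) (f y).
have [q [xq <- szq _]] := subst_walk_lift xp py.
by apply: leq_trans szq; rewrite leq_mul2l gdist_le// orbT.
Qed.

(** A closure is connected within itself, so its diameter is at most its size, which [hull_map]
    bounds by the size of one fixed closure. *)
Lemma closure_diam : exists k, forall C x y, cell C -> gclosure C x ->
  gclosure C y -> (gdist x y <= k)%N.
Proof.
have [C0 [_ [_ [hC0 _ _ _ _]]]] := X_nu.
exists (ncard (gclosure C0)) => C x y hC Cx Cy.
have finC := hss_finite X_hss.
apply: leq_trans (gdist_finite_within (finC _ hC) (closure_walk hC Cx Cy)) _.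
have [a [acl _ ainj _]] := hull_map hC hC0.
exact: ncard_inj (finC _ hC) (finC _ hC0) acl ainj.
Qed.

(** * Cliques, parents and children *)

Definition clique C : set X := [set x | bdry C (f x)].

Definition clique_pairs C : set (X * X) :=
  [set p | [/\ clique C p.1, clique C p.2 & p.1 <> p.2]].

Definition hull_arcs P : set (X * X) :=
  [set p | [/\ gclosure P p.1, gclosure P p.2 & adj p.1 p.2]].

(** The counterpart, pulled back along f, of the cells contained in a 2-cell; see
    [two_cell_children]. *)
Definition children P : set (set X) :=
  [set C | cell C /\ clique C `<=` gclosure P].

(** The block of the edge partition that holds the arc [p]. The choice is meaningful, and unique by
    [clique_eq], only for adjacent endpoints. *)
Definition cell_of (p : X * X) : set X :=
  xget set0 [set C | [/\ cell C, clique C p.1 & clique C p.2]].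

Lemma adj_neq x y : adj x y -> x <> y.
Proof. by move=> xy exy; move: xy; rewrite exy adj_irr. Qed.

Lemma clique_adj C x y : cell C -> clique C x -> clique C y -> x <> y -> adj x y.
Proof. by move=> hC Cx Cy xy; apply/subst_adj; split=> //; exists C. Qed.

Lemma cell_ofP p : adj p.1 p.2 ->
  [/\ cell (cell_of p), clique (cell_of p) p.1 & clique (cell_of p) p.2].
Proof.
move=> /subst_adj[_ [C hC [C1 C2]]].
pose S := [set C | [/\ cell C, clique C p.1 & clique C p.2]].
by apply: (@xgetPex _ set0 S); exists C.
Qed.

Lemma clique_eq C D x y : cell C -> cell D -> x <> y ->
  clique C x -> clique C y -> clique D x -> clique D y -> C = D.
Proof.
move=> hC hD xy Cx Cy Dx Dy; apply: (@cell_eq C D (f x) (f y)) => //; try by right.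
by move=> /subst_inj.
Qed.

Lemma cell_of_eq p C : cell C -> clique_pairs C p -> cell_of p = C.
Proof.
move=> hC [C1 C2 p12]; have [hD D1 D2] := cell_ofP (clique_adj hC C1 C2 p12).
exact: clique_eq hD hC p12 D1 D2 C1 C2.
Qed.

Lemma cell_of_pairs p : adj p.1 p.2 -> clique_pairs (cell_of p) p.
Proof. by move=> p12; have [_ C1 C2] := cell_ofP p12; split=> //; apply: adj_neq. Qed.

Lemma finite_bdry C : cell C -> finite_set (bdry C).
Proof.
by move=> /(hss_finite X_hss); apply: sub_finite_set => v; right.
Qed.

Lemma finite_clique C : cell C -> finite_set (clique C).
Proof.
by move=> /finite_bdry finC; apply: (finite_preimage _ finC) => x y _ _ /subst_inj.
Qed.

Lemma finite_pairs (A B : set X) (S : set (X * X)) : finite_set A -> finite_set B ->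
  (forall p, S p -> A p.1 /\ B p.2) -> finite_set S.
Proof.
by move=> finA finB SAB; apply: sub_finite_set (finite_setX finA finB).
Qed.

Lemma finite_clique_pairs C : cell C -> finite_set (clique_pairs C).
Proof.
by move=> /finite_clique fC; apply: (finite_pairs fC fC) => p [].
Qed.

Lemma finite_hull_arcs P : cell P -> finite_set (hull_arcs P).
Proof.
by move=> /(hss_finite X_hss) fP; apply: (finite_pairs fP fP) => p [].
Qed.

Lemma clique2 C : cell C -> exists p, clique_pairs C p.
Proof.
move=> hC; have [v [w [Cv Cw vw]]] := cell_bdry2 hC.
have [x xv] := subst_surj (bdry_F hC Cv); have [y yw] := subst_surj (bdry_F hC Cw).
exists (x, y); split; rewrite /clique /= ?xv ?yw// => xy.
by apply: vw; rewrite -xv -yw xy.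
Qed.

Lemma ncard_clique_pairs_le C D : cell C -> cell D ->
  (ncard (clique_pairs C) <= ncard (clique_pairs D))%N.
Proof.
move=> hC hD; have [a [_ abdry ainj _]] := hull_map hC hD.
(* [g] is the hull map conjugated by f, so it carries the clique of [C] into that of [D]; off the
   clique its value is arbitrary. *)
have [g fg] : exists g : X -> X, forall x, clique C x -> f (g x) = a (f x).
  suff /choice[g fg] : forall x, exists y, clique C x -> f y = a (f x) by exists g.
  move=> x.
  have [Cx|nCx] := pselect (clique C x); last by exists x.
  by have [y yx] := subst_surj (bdry_F hD (abdry _ Cx)); exists y.
have ginj x y : clique C x -> clique C y -> g x = g y -> x = y.
  move=> Cx Cy /(congr1 f); rewrite !fg// => /ainj h.
  by apply: subst_inj; apply: h; right.
apply: (@ncard_inj _ _ _ _ (fun p => (g p.1, g p.2))).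
- exact: finite_clique_pairs.
- exact: finite_clique_pairs.
- move=> p [C1 C2 p12]; split; rewrite /clique /= ?fg//; try exact: abdry.
  by move=> /ginj; auto.
- move=> [x1 x2] [y1 y2] [/= ? ? _] [/= ? ? _] [/ginj -> // /ginj -> //].
Qed.

Lemma ncard_clique_pairs C D : cell C -> cell D ->
  ncard (clique_pairs C) = ncard (clique_pairs D).
Proof. by move=> hC hD; apply/eqP; rewrite eqn_leq !ncard_clique_pairs_le. Qed.

Lemma ncard_hull_arcs_le C D : cell C -> cell D ->
  (ncard (hull_arcs C) <= ncard (hull_arcs D))%N.
Proof.
move=> hC hD; have [a [acl _ ainj aadj]] := hull_map hC hD.
apply: (@ncard_inj _ _ _ _ (fun p => (a p.1, a p.2))).
- exact: finite_hull_arcs.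
- exact: finite_hull_arcs.
- by move=> p [C1 C2 p12]; split; rewrite /= ?aadj//; apply: acl.
- move=> [x1 x2] [y1 y2] [/= ? ? _] [/= ? ? _] [/ainj -> // /ainj -> //].
Qed.

Lemma ncard_hull_arcs C D : cell C -> cell D ->
  ncard (hull_arcs C) = ncard (hull_arcs D).
Proof. by move=> hC hD; apply/eqP; rewrite eqn_leq !ncard_hull_arcs_le. Qed.

Lemma closure_notF P u : gclosure P u -> cell P -> ~ F u -> P u.
Proof. by move=> [//|Pu] hP nFu; case: nFu; apply: bdry_F hP Pu. Qed.

(** All other vertices of the clique are neighbours of [u], and neighbours of a vertex of [P] stay
    in the closure. *)
Lemma clique_sub_closure C P u : cell C -> cell P -> clique C u -> P u ->
  clique C `<=` gclosure P.
Proof.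
move=> hC hP Cu Pu x Cx; have [->|ux] := pselect (x = u); first by left.
by apply: closure_adj hP Pu _; apply: (clique_adj hC Cu Cx) => /esym.
Qed.

Lemma adj_notF x y : adj x y -> ~ F x \/ ~ F y.
Proof.
move=> xy; have [Fx|] := pselect (F x); last by left.
by right=> Fy; have := ss_independent X_ss Fx Fy; rewrite xy.
Qed.

Lemma clique_notF C : cell C -> exists2 u, clique C u & ~ F u.
Proof.
move=> hC; have [[x y] [/= Cx Cy xy]] := clique2 hC.
by have [nF|nF] := adj_notF (clique_adj hC Cx Cy xy); [exists x|exists y].
Qed.

(** By (F1) a clique has a vertex off [F]; the component of that vertex is the parent. *)
Lemma parent_exists C : cell C -> exists2 P, cell P & children P C.
Proof.
move=> hC; have [u Cu nFu] := clique_notF hC.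
have hP : cell (walk_within (~` F) u) by exact: component_of.
exists (walk_within (~` F) u) => //; split=> //.
exact: clique_sub_closure hC hP Cu (walk_within_refl nFu).
Qed.

(** Both closures contain two distinct vertices of the clique of [C], so (F2) applies. *)
Lemma parent_eq C P Q : cell P -> cell Q -> children P C -> children Q C -> P = Q.
Proof.
move=> hP hQ [hC CP] [_ CQ]; have [p [C1 C2 p12]] := clique2 hC.
by apply: (cell_eq hP hQ p12); auto.
Qed.

Lemma hull_arcs_child P p : cell P -> hull_arcs P p -> children P (cell_of p).
Proof.
move=> hP [P1 P2 p12]; have [hC C1 C2] := cell_ofP p12; split=> //.
have [nF|nF] := adj_notF p12.
  exact: clique_sub_closure hC hP C1 (closure_notF P1 hP nF).
exact: clique_sub_closure hC hP C2 (closure_notF P2 hP nF).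
Qed.

Lemma hull_arcs_fiber P C : cell P -> children P C ->
  [set p | hull_arcs P p /\ cell_of p = C] = clique_pairs C.
Proof.
move=> hP [hC CP]; apply/seteqP; split=> p.
  by move=> [[_ _ p12] <-]; apply: cell_of_pairs.
move=> pC; have [C1 C2 p12] := pC; split; last exact: cell_of_eq.
by split; [exact: CP|exact: CP|exact: clique_adj hC C1 C2 p12].
Qed.

Lemma children_image P : cell P -> children P = cell_of @` hull_arcs P.
Proof.
move=> hP; apply/seteqP; split=> C; last by move=> [p hp <-]; apply: hull_arcs_child.
move=> PC; have [p pC] := clique2 PC.1; exists p; last exact: cell_of_eq PC.1 pC.
by have := pC; rewrite -(hull_arcs_fiber hP PC) => -[].
Qed.

Lemma finite_children P : cell P -> finite_set (children P).
Proof. by move=> hP; rewrite children_image//; apply/finite_image/finite_hull_arcs. Qed.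

(** [cell_of] sends the arcs of the hull to children; the fiber over a child is its set of clique
    pairs, and these sets all have the same size. *)
Lemma ncard_hull_arcsE P C : cell P -> cell C ->
  ncard (hull_arcs P) = (ncard (clique_pairs C) * ncard (children P))%N.
Proof.
move=> hP hC; have fP := finite_hull_arcs hP; have fcP := finite_children hP.
have mem p : hull_arcs P p -> children P (cell_of p) by exact: hull_arcs_child.
apply/eqP; rewrite eqn_leq; apply/andP; split.
  apply: (ncard_fibers_le fP fcP mem) => D PD.
  by rewrite (hull_arcs_fiber hP PD) (ncard_clique_pairs PD.1 hC).
apply: (ncard_fibers_ge fP fcP mem) => D PD.
by rewrite (hull_arcs_fiber hP PD) (ncard_clique_pairs PD.1 hC).
Qed.

(** By (H1) the hulls have equally many arcs; cancel the common positive number of clique pairs. *)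
Lemma ncard_children P Q : cell P -> cell Q ->
  ncard (children P) = ncard (children Q).
Proof.
move=> hP hQ; have := ncard_hull_arcs hP hQ.
rewrite (ncard_hull_arcsE hP hP) (ncard_hull_arcsE hQ hP) => /eqP.
have [p pP] := clique2 hP.
by rewrite eqn_pmul2l; [move/eqP|apply: ncard_gt0 (finite_clique_pairs hP) pP].
Qed.

(* A 2-cell D is the counterpart under f of a cell P: f u lies in D
   exactly for the u in P when u is off F, so the cells inside D are the children of P. *)
Section TwoCell.
Variable D : set X.
Hypothesis D_2cell : ncells psi 2 D.

Lemma iter2E v : iterF psi 2 v <-> exists2 x, F x & f x = v.
Proof.
split=> [[x _ <-]|[v' /subst_surj[x <-] <-]]; last by exists x.
by exists (f x); first exact: subst_in.
Qed.

Lemma iter2_subst x : iterF psi 2 (f x) <-> F x.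
Proof.
by rewrite iter2E; split=> [[y Fy /subst_inj <-]|Fx]; last by exists x.
Qed.

Lemma iter2_sub v : iterF psi 2 v -> F v.
Proof. by move=> /iter2E[x _ <-]; apply: subst_in. Qed.

(** [f u] is adjacent to a vertex of [C] and, since [u] is off [F], is not in [iterF psi 2]; the
    component [D] absorbs it. *)
Lemma two_cell_clique C u : cell C -> C `<=` D -> clique C u -> ~ F u -> D (f u).
Proof.
move=> hC CD [_ [c Cc cu]] nFu; apply: component_adj D_2cell (CD _ Cc) cu _.
by move=> /iter2_subst.
Qed.

Lemma two_cell_sub C u : cell C -> clique C u -> D (f u) -> C `<=` D.
Proof.
move=> hC [_ [c Cc cu]] Du.
have nF2 : ~` F `<=` ~` iterF psi 2 by move=> z nFz /iter2_sub.
have Dc : D c.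
  apply: (component_adj D_2cell Du); first by rewrite adj_sym.
  exact/nF2/(cell_notF hC Cc).
move=> z Cz; apply: (component_absorb D_2cell Dc _).
exact: walk_within_sub nF2 (component_walk hC Cc Cz).
Qed.

Lemma two_cell_adj u v : adj u v -> ~ F v -> D (f u) -> D (f v).
Proof.
move=> /subst_adj[_ [C hC [Cu Cv]]] nFv Du.
exact: two_cell_clique hC (two_cell_sub hC Cu Du) Cv nFv.
Qed.

Lemma two_cell_walk u v : D (f u) -> walk_within (~` F) u v -> D (f v).
Proof.
move=> + [p [up <- pF]]; elim: p u up pF => //= w p IH u /andP[uw wp] pF Du.
apply: IH => // [z zp|]; first by apply: pF; rewrite inE zp orbT.
by apply: (two_cell_adj uw _ Du); apply: pF; rewrite !inE eqxx orbT.
Qed.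

(** A walk inside [D] avoids [iterF psi 2]; since f maps the vertices of its lift into it, the lift
    avoids [F]. *)
Lemma two_cell_subst_walk u v : D (f u) -> D (f v) -> walk_within (~` F) u v.
Proof.
move=> Du Dv; have [p [up pv pF]] := component_walk D_2cell Du Dv.
have [q [uq qv _ qp]] := subst_walk_lift up pv; exists q; split=> // z.
rewrite inE => /orP[/eqP->|/qp zp] Fz.
  by apply: (component_sub D_2cell Du); apply/iter2_subst.
by apply: (pF (f z)); [rewrite inE zp orbT|apply/iter2_subst].
Qed.

Lemma two_cell_meets : exists2 u, ~ F u & D (f u).
Proof.
have [d nd eD] := D_2cell; have Dd : D d by rewrite eD; apply: walk_within_refl.
have [/subst_surj[u ud]|nFd] := pselect (F d).
  exists u; last by rewrite ud.
  by move=> Fu; apply: nd; rewrite -ud; apply/iter2_subst.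
have hC : cell (walk_within (~` F) d) by exact: component_of.
have [u Cu nFu] := clique_notF hC; exists u => //.
apply: two_cell_clique hC _ Cu nFu; rewrite eD => z.
by apply: walk_within_sub => w nFw /iter2_sub.
Qed.

Lemma two_cell_children :
  exists2 P, cell P & [set C | cell C /\ C `<=` D] = children P.
Proof.
have [u nFu Du] := two_cell_meets.
have hP : cell (walk_within (~` F) u) by exact: component_of.
exists (walk_within (~` F) u) => //; apply/seteqP; split=> C [hC sC]; split=> //.
  have [v Cv nFv] := clique_notF hC.
  apply: (clique_sub_closure hC hP Cv).
  exact: two_cell_subst_walk Du (two_cell_clique hC sC Cv nFv).
have [v Cv nFv] := clique_notF hC; apply: (two_cell_sub hC Cv).
exact: two_cell_walk Du (closure_notF (sC _ Cv) hP nFv).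
Qed.

End TwoCell.

(** * The volume scaling factor *)

Variable mu : nat.
Hypothesis X_mu : volume_scaling psi mu.

Lemma ncard_children_mu P : cell P -> ncard (children P) = mu.
Proof.
move=> hP; have [D hD cD] := X_mu; have [Q hQ eQ] := two_cell_children hD.
by rewrite (ncard_children hP hQ) -eQ; apply: card_fset_set.
Qed.

Definition parent C : set X := xget set0 [set P | cell P /\ children P C].

Lemma parentP C : cell C -> cell (parent C) /\ children (parent C) C.
Proof.
move=> /parent_exists[P hP PC].
by apply: (@xgetPex _ set0 [set P | cell P /\ children P C]); exists P.
Qed.

Lemma parentE C P : cell P -> children P C -> parent C = P.
Proof.
move=> hP PC; have [hQ QC] := parentP PC.1; exact: parent_eq hQ hP QC PC.
Qed.

Lemma volume_scaling_gt0 : (0 < mu)%N.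
Proof.
have [C [_ [_ [hC _ _ _ _]]]] := X_nu; have [P hP PC] := parent_exists hC.
by rewrite -(ncard_children_mu hP); apply: ncard_gt0 (finite_children hP) PC.
Qed.

(** * Arcs and cells of balls *)

Hypothesis X_lf : locally_finite X.

(** Arcs are counted by their starting point, so their number is the volume of the ball; see
    [volE]. *)
Definition ball_arcs x (r : nat) : set (X * X) :=
  [set p | gball x r p.1 /\ adj p.1 p.2].

Definition ball_cells x (r : nat) : set (set X) :=
  [set C | cell C /\ exists2 z, clique C z & gball x r z].

Lemma finite_arcs_from (A : set X) : finite_set A ->
  finite_set [set p : X * X | A p.1 /\ adj p.1 p.2].
Proof.
move=> finA.
have -> : [set p : X * X | A p.1 /\ adj p.1 p.2] =
    \bigcup_(y in A) (pair y @` nbrs y).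
  apply/seteqP; split=> [[y z] [/= Ay yz]|_ [y Ay [z yz <-]]] //=.
  by exists y => //; exists z.
by apply: bigcup_finite => // y _; apply/finite_image/X_lf.
Qed.

Lemma gball0 x : gball x 0 = [set x].
Proof.
apply/seteqP; split=> y; rewrite /gball /=; last by move=> ->; rewrite gdistxx.
by have [p [yp <- <-]] := gdist_walk X_conn y x; case: p {yp}.
Qed.

(** The second vertex of a geodesic from [y] to [x] is one step closer to [x]. *)
Lemma gball_succ x r : gball x r.+1 `<=` gball x r `|` snd @` ball_arcs x r.
Proof.
move=> y; rewrite /gball /=.
have [p [yp px <-]] := gdist_walk X_conn y x; case: p yp px => [_ /= <-|z p].
  by left.
move=> /= /andP[yz zp] zx pr; right; exists (z, y) => //; split=> /=.
  by rewrite /gball /= -zx; apply: leq_trans (gdist_le zp) _.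
by rewrite adj_sym.
Qed.

Lemma finite_gball x r : finite_set (gball x r).
Proof.
elim: r => [|r IH]; first by rewrite gball0; apply: finite_set1.
apply: (sub_finite_set (@gball_succ x r)); rewrite finite_setU; split=> //.
exact/finite_image/finite_arcs_from.
Qed.

Lemma finite_ball_arcs x r : finite_set (ball_arcs x r).
Proof. exact/finite_arcs_from/finite_gball. Qed.

Lemma ncard_ball_arcs x r :
  ncard (ball_arcs x r) = (\sum_(y <- fset_set (gball x r)) deg y)%N.
Proof.
rewrite (ncard_fibers (finite_ball_arcs x r) (finite_gball x r) (g := fst)).
  rewrite big_seq [RHS]big_seq; apply: eq_bigr => y.
  rewrite in_fset_set ?inE => [By|]; last exact: finite_gball.
  have fin1 : finite_set [set p | ball_arcs x r p /\ p.1 = y].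
    by apply: sub_finite_set (finite_ball_arcs x r) => p [].
  apply/eqP; rewrite eqn_leq; apply/andP; split.
    apply: (@ncard_inj _ _ _ (nbrs y) snd) => //.
      by move=> [u v] [[/= _ uv] <-].
    by move=> [u v] [u' v'] [_ /= ->] [_ /= ->] ->.
  by apply: (@ncard_inj _ _ (nbrs y) _ (pair y)) => // u v _ _ [].
by move=> p [].
Qed.

Lemma ball_cellsE x r : ball_cells x r = cell_of @` ball_arcs x r.
Proof.
apply/seteqP; split=> C.
  move=> [hC [z Cz Bz]]; have [[u v] [/= Cu Cv uv]] := clique2 hC.
  (* A clique has two distinct vertices, so [z] has a partner [w], and the arc from [z] to [w]
     starts in the ball. *)
  have [w Cw zw] : exists2 w, clique C w & z <> w.
    have [zu|] := pselect (z = u); last by exists u.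
    by exists v => //; rewrite zu.
  exists (z, w); first by split=> //; apply: clique_adj hC Cz Cw zw.
  by apply: cell_of_eq => //; split.
move=> [p [Bp pp] <-]; have [hC C1 _] := cell_ofP pp.
by split=> //; exists p.1.
Qed.

Lemma finite_ball_cells x r : finite_set (ball_cells x r).
Proof. by rewrite ball_cellsE; apply/finite_image/finite_ball_arcs. Qed.

Lemma ncard_ball_cells_le x r : (ncard (ball_cells x r) <= ncard (ball_arcs x r))%N.
Proof. by rewrite ball_cellsE; apply/ncard_image/finite_ball_arcs. Qed.

(** Arcs with the same [cell_of] are clique pairs of that cell. *)
Lemma ncard_ball_arcs_le C x r : cell C ->
  (ncard (ball_arcs x r) <= ncard (clique_pairs C) * ncard (ball_cells x r))%N.
Proof.
move=> hC; apply: (@ncard_fibers_le _ _ _ _ cell_of).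
- exact: finite_ball_arcs.
- exact: finite_ball_cells.
- by move=> p Bp; rewrite ball_cellsE; exists p.
- move=> D [hD _]; rewrite (ncard_clique_pairs hC hD); apply: ncard_sub.
    exact: finite_clique_pairs.
  by move=> p [[_ pp] <-]; apply: cell_of_pairs.
Qed.

Lemma ball_cells_mono x r s : (r <= s)%N -> ball_cells x r `<=` ball_cells x s.
Proof.
move=> rs C [hC [z Cz Bz]]; split=> //; exists z => //.
exact: leq_trans Bz rs.
Qed.

Lemma has_neighbour x : exists y, adj x y.
Proof.
have [_ [v [w [_ _ _ vw _]]]] := X_nu.
have [y xy] : exists y, x <> y.
  by have [xv|] := pselect (x = v); [exists w; rewrite xv|exists v].
have [[|z p] [/= xp py _]] := gdist_walk X_conn x y => //.
by exists z; move: xp => /andP[].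
Qed.

Lemma ball_cells_gt0 x r : (0 < ncard (ball_cells x r))%N.
Proof.
have [y xy] := has_neighbour x; have [hC Cx _] := @cell_ofP (x, y) xy.
apply: (ncard_gt0 (finite_ball_cells x r) (x := cell_of (x, y))).
by split=> //; exists x => //; rewrite /gball /= gdistxx.
Qed.

(** * Recursion for the number of cells meeting a ball *)

Section Diameter.
Variable k : nat.
Hypothesis k_diam : forall C x y, cell C -> gclosure C x -> gclosure C y ->
  (gdist x y <= k)%N.

Lemma subst_near y : exists x, (gdist y (f x) <= k)%N.
Proof.
have [/subst_surj[x <-]|nFy] := pselect (F y).
  by exists x; rewrite gdistxx.
have hC : cell (walk_within (~` F) y) by exact: component_of.
have [v [_ [Cv _ _]]] := cell_bdry2 hC; have [x xv] := subst_surj (bdry_F hC Cv).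
exists x; rewrite xv; apply: k_diam hC _ _; last by right.
by left; apply: walk_within_refl.
Qed.

(** Count the cells whose parent is in [ball_cells x r]: [mu] for each parent. The clique of such a
    child is within [k] of some [f z] with [z] in the ball, [f z] is within [nu * r] of [f x], and
    [f x] is within [k] of [y]. *)
Lemma ball_cells_lower x y r : (gdist y (f x) <= k)%N ->
  (mu * ncard (ball_cells x r) <= ncard (ball_cells y (nu * r + 2 * k)))%N.
Proof.
move=> yx; set S := [set C | cell C /\ ball_cells x r (parent C)].
have finB := finite_ball_cells y (nu * r + 2 * k).
have SB : S `<=` ball_cells y (nu * r + 2 * k).
  move=> C [hC [hP [z Pz Bz]]]; have [_ [_ CP]] := parentP hC; split=> //.
  have [[u _] [/= Cu _ _]] := clique2 hC; exists u => //; rewrite /gball /=.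
  have uz : (gdist u (f z) <= k)%N by apply: k_diam hP (CP _ Cu) _; right.
  have := gdist_triangle X_conn u (f z) y.
  have := gdist_triangle X_conn (f z) (f x) y.
  rewrite subst_dist (gdistC X_conn (f x)).
  have : (nu * gdist z x <= nu * r)%N by rewrite leq_mul2l Bz orbT.
  lia.
apply: leq_trans (ncard_sub finB SB).
apply: (@ncard_fibers_ge _ _ S _ parent) => //.
- exact: sub_finite_set SB finB.
- exact: finite_ball_cells.
- by move=> C [].
move=> P BP; rewrite -(ncard_children_mu BP.1).
apply: ncard_sub => [|C PC]; first by apply: sub_finite_set finB => C [/SB].
by have PE := parentE BP.1 PC; split=> //; split; rewrite ?PE//; case: PC.
Qed.

(** Send each cell to its parent, so that fibers have at most [mu] elements. A boundary vertex [f w]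
    of the parent satisfies [nu * gdist w x = gdist (f w) (f x) <= s + 2 * k]; dividing by [nu] puts
    [w] in the ball of radius [t]. *)
Lemma ball_cells_upper x y s t : (gdist y (f x) <= k)%N -> (s + 2 * k <= nu * t)%N ->
  (ncard (ball_cells y s) <= mu * ncard (ball_cells x t))%N.
Proof.
move=> yx st; apply: (@ncard_fibers_le _ _ _ _ parent).
- exact: finite_ball_cells.
- exact: finite_ball_cells.
- move=> C [hC [u Cu Bu]]; have [hP [_ CP]] := parentP hC; split=> //.
  have [v [_ [Pv _ _]]] := cell_bdry2 hP; have [w wv] := subst_surj (bdry_F hP Pv).
  exists w; rewrite /clique /= ?wv// /gball /=.
  have uv : (gdist (f w) u <= k)%N by rewrite wv; apply: k_diam hP _ (CP _ Cu); right.
  rewrite -(@leq_pmul2l nu); last by have := length_scaling_gt1; lia.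
  rewrite -subst_dist.
  have := gdist_triangle X_conn (f w) u (f x).
  have := gdist_triangle X_conn u y (f x).
  move: Bu; rewrite /gball /=; lia.
- move=> P [hP _]; rewrite -(ncard_children_mu hP).
  apply: ncard_sub; first exact: finite_children.
  by move=> C [[hC _] <-]; have [] := parentP hC.
Qed.

(** The radii r_n = 2k(nu^n - 1) start at 0 and satisfy nu r_n + 2k <= r_(n+1) because nu >= 2. *)
Lemma ball_cells_lower_iter n x :
  (mu ^ n <= ncard (ball_cells x (2 * k * (nu ^ n).-1)))%N.
Proof.
elim: n x => [|n IH] y; first exact: ball_cells_gt0.
have [x yx] := subst_near y.
rewrite expnS; apply: leq_trans (leq_mul (leqnn mu) (IH x)) _.
apply: leq_trans (ball_cells_lower _ yx) _.
apply: ncard_sub; first exact: finite_ball_cells.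
apply: ball_cells_mono.
have nu1 := length_scaling_gt1; have : (0 < nu ^ n)%N by rewrite expn_gt0; lia.
rewrite expnS; case: (nu ^ n)%N => // a _; case: nu nu1 => // -[//|d] _.
rewrite /= !mulSn !mulnS; nia.
Qed.

(* The radii t_n = nu^n + 2k satisfy t_(n+1) + 2k <= nu t_n because nu >= 2. *)
Lemma ball_cells_upper_iter B n y :
  (forall x, ncard (ball_cells x (2 * k).+1) <= B)%N ->
  (ncard (ball_cells y (nu ^ n + 2 * k)) <= B * mu ^ n)%N.
Proof.
move=> hB; elim: n y => [|n IH] y; first by rewrite muln1; apply: hB.
have [x yx] := subst_near y.
apply: leq_trans (ball_cells_upper (t := nu ^ n + 2 * k) yx _) _.
  by rewrite expnS; have := length_scaling_gt1; nia.
by rewrite expnS mulnCA leq_mul2l IH orbT.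
Qed.

End Diameter.

Lemma ball_arcs_growth : bounded_geometry X -> exists c B,
  [/\ (0 < c)%N, (0 < B)%N,
    forall n x r, (c * nu ^ n <= r)%N -> (mu ^ n <= ncard (ball_arcs x r))%N &
    forall n x r, (r <= nu ^ n)%N -> (ncard (ball_arcs x r) <= B * mu ^ n)%N].
Proof.
move=> [M degM].
have arcsM x r : (ncard (ball_arcs x r) <= M * ncard (gball x r))%N.
  rewrite ncard_ball_arcs /ncard card_fset_sum1 big_distrr /=.
  by apply: leq_sum => y _; rewrite muln1.
(* A crude exponential bound, applied below only at the fixed radius [(2 * k).+1]. *)
have ballM x r : (ncard (gball x r) <= M.+1 ^ r)%N.
  elim: r => [|r IH]; first by rewrite gball0 /ncard fset_set1 cardfs1.
  have fB := finite_gball x r; have fA := finite_ball_arcs x r.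
  have fI : finite_set (snd @` ball_arcs x r) by exact: finite_image.
  have fU : finite_set (gball x r `|` snd @` ball_arcs x r) by rewrite finite_setU.
  apply: leq_trans (ncard_sub fU (@gball_succ x r)) _.
  apply: leq_trans (ncard_setU fB fI) _; rewrite expnS mulSn; apply: leq_add => //.
  apply: leq_trans (ncard_image _ fA) _; apply: leq_trans (arcsM x r) _.
  by rewrite leq_mul2l IH orbT.
have [k k_diam] := closure_diam.
have [C [_ [_ [hC _ _ _ _]]]] := X_nu.
(* [B] bounds the number of arcs starting in a ball of radius [(2 * k).+1], the radius at which the
   upper recursion begins; its successor is used below to ensure positivity. *)
pose B := (M * M.+1 ^ (2 * k).+1)%N.
exists (2 * k).+1, (ncard (clique_pairs C) * B.+1)%N; split=> //.
- rewrite muln_gt0 /= andbT; have [p Cp] := clique2 hC.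
  exact: ncard_gt0 (finite_clique_pairs hC) Cp.
- move=> n x r nr; apply: leq_trans (ball_cells_lower_iter k_diam n x) _.
  apply: leq_trans (ncard_ball_cells_le _ _); apply: ncard_sub.
    exact: finite_ball_cells.
  by apply: ball_cells_mono; nia.
- move=> n x r rn; apply: leq_trans (ncard_ball_arcs_le x r hC) _.
  rewrite -mulnA leq_mul2l; apply/orP; right.
  have smallB y : (ncard (ball_cells y (2 * k).+1) <= B.+1)%N.
    apply: leqW; apply: leq_trans (ncard_ball_cells_le _ _) _.
    by apply: leq_trans (arcsM _ _) _; rewrite leq_mul2l ballM orbT.
  apply: leq_trans (ball_cells_upper_iter k_diam n x smallB).
  apply: ncard_sub; first exact: finite_ball_cells.
  by apply: ball_cells_mono; lia.
Qed.

Lemma volE (R : realType) x r :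
  vol R (gball x r) = (ncard (ball_arcs x r))%:R%:E.
Proof.
rewrite /vol esum_fset ?fsbig_finite//; try exact: finite_gball.
by rewrite ncard_ball_arcs natr_sum sumEFin.
Qed.

End Cells.

(** * From volume bounds to growth exponents *)

Section LogarithmicGrowth.
Variable R : realType.
Local Open Scope ring_scope.

Lemma ln_natr_cvgy : ln (r%:R : R) @[r --> \oo] --> +oo.
Proof.
apply/cvgryPge => A.
have /cvgryPge/(_ (expR A)) := @cvgr_idn R; apply: filterS => r Ar.
rewrite -[A]expRK ler_ln// posrE ?expR_gt0//.
exact: lt_le_trans (expR_gt0 A) Ar.
Qed.

Lemma addr_div_ln_cvg (a K : R) :
  (a + K / ln (r%:R : R))%:E @[r --> \oo] --> a%:E.
Proof.
apply: cvg_EFin; first by apply: nearW.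
rewrite -[X in _ --> X]addr0; apply: cvgD; first exact: cvg_cst.
rewrite -[X in _ --> X](mulr0 K); apply: cvgM; first exact: cvg_cst.
apply/gtr0_cvgV0; last exact: ln_natr_cvgy.
by apply: filterS (nbhs_infty_gt 1) => r r1; rewrite ln_gt0// ltr1n.
Qed.

(** Comparing [r] with powers of [nu] shows that [lne (u r)] differs from (a/b) ln r by a bounded
    amount, with a = ln mu and b = ln nu. Division by ln r leaves an error of order 1 / ln r. *)
Lemma growth_exponent_cvg (u : nat -> \bar R) (mu nu c B : nat) :
  (0 < mu)%N -> (1 < nu)%N -> (0 < c)%N -> (0 < B)%N ->
  (forall n r : nat, (c * nu ^ n <= r)%N -> ((mu ^ n)%N%:R%:E <= u r)%E) ->
  (forall n r : nat, (r <= nu ^ n)%N -> (u r <= (B * mu ^ n)%N%:R%:E)%E) ->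
  (lne (u r) / (ln (r%:R : R))%:E)%E @[r --> \oo] --> (ln mu%:R / ln nu%:R : R)%:E.
Proof.
move=> mu0 nu1 c0 B0 lo hi.
set a := ln mu%:R; set b := ln nu%:R.
have a0 : 0 <= a by rewrite ln_ge0// ler1n.
have b0 : 0 < b by rewrite ln_gt0// ltr1n.
have pos (m : nat) : (0 < m)%N -> (m%:R : R) \in Num.pos by rewrite posrE ltr0n.
have lnexp m n : (0 < m)%N -> ln ((m ^ n)%N%:R) = n%:R * ln m%:R :> R.
  by move=> m0; rewrite natrX lnXn ?ltr0n// mulr_natl.
(* The constants come from n a >= (a/b)(ln r - ln c - b) below and from ln B + (n' + 1) a <= (a/b)
   ln r + ln B + a above. *)
apply: (squeeze_cvge _ (@addr_div_ln_cvg (a / b) (- (a / b * (ln c%:R + b))))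
  (@addr_div_ln_cvg (a / b) (ln B%:R + a))).
near=> r.
have r1 : (1 < r)%N by near: r; exact: nbhs_infty_gt.
have rc : (c <= r)%N by near: r; exact: nbhs_infty_ge.
have r0 : (0 < r)%N by exact: ltnW.
have lr : 0 < ln (r%:R : R) by rewrite ln_gt0// ltr1n.
(* [n] is the largest exponent with c nu^n <= r, and [n'] the largest with nu^n' <= r. *)
set n := trunc_log nu (r %/ c); set n' := trunc_log nu r.
have lo_r : ((mu ^ n)%N%:R%:E <= u r)%E.
  apply: lo; rewrite mulnC -leq_divRL//; apply: trunc_logP => //.
  by rewrite divn_gt0.
have hi_r : (u r <= (B * mu ^ n'.+1)%N%:R%:E)%E.
  by apply/hi/ltnW/trunc_log_ltn.
have r_lt : ln r%:R <= ln c%:R + (n%:R + 1) * b.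
  have : (r < c * nu ^ n.+1)%N by rewrite mulnC -ltn_divLR//; apply: trunc_log_ltn.
  move=> /ltnW; rewrite -(ler_nat R) => rle.
  apply: (@le_trans _ _ (ln (c * nu ^ n.+1)%N%:R)).
    by rewrite ler_ln ?pos// muln_gt0 c0 expn_gt0 ltnW.
  rewrite natrM lnM ?pos//; last by rewrite expn_gt0 ltnW.
  by rewrite lnexp 1?ltnW// -natr1.
have r_ge : n'%:R * b <= ln r%:R.
  rewrite -lnexp 1?ltnW// ler_ln ?pos ?expn_gt0 1?ltnW// ler_nat.
  exact: trunc_logP.
have mun m : (0 < mu ^ m)%N by rewrite expn_gt0 mu0.
have hlo : ((n%:R * a)%:E <= lne (u r))%E.
  rewrite -lnexp// -lne_EFin ?ltr0n// lee_lne// in_itv /= leey andbT ?lee_fin//.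
  by apply: le_trans lo_r; rewrite lee_fin.
have hhi : (lne (u r) <= (ln B%:R + (n'%:R + 1) * a)%:E)%E.
  rewrite natr1 -lnexp// -lnM ?pos// -natrM -lne_EFin ?ltr0n ?muln_gt0 ?B0 ?mun//.
  (* The side condition that [u r] is nonnegative follows from the lower bound [lo_r]. *)
  rewrite lee_lne// in_itv /= leey andbT ?lee_fin//.
  by apply: le_trans lo_r; rewrite lee_fin.
have iE : ((ln (r%:R : R))%:E^-1 = (ln (r%:R : R))^-1%:E)%E.
  by rewrite inver gt_eqF.
have i0 : (0 <= (ln (r%:R : R))^-1%:E)%E by rewrite lee_fin invr_ge0 ltW.
rewrite iE; apply/andP; split.
  apply: le_trans (lee_wpmul2r i0 hlo); rewrite -EFinM lee_fin.
  rewrite ler_pdivlMr// mulrDl mulfVK ?gt_eqF//.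
  have -> : n%:R * a = a / b * (n%:R * b).
    by rewrite mulrCA mulrA -mulrA divfK ?gt_eqF// mulrC.
  rewrite -mulrN -mulrDr; apply: ler_wpM2l; first by rewrite divr_ge0// ltW.
  lra.
apply: le_trans (lee_wpmul2r i0 hhi) _; rewrite -EFinM lee_fin.
rewrite ler_pdivrMr// [leRHS]mulrDl mulfVK ?gt_eqF//.
have : a / b * (n'%:R * b) <= a / b * ln r%:R.
  by apply: ler_wpM2l r_ge; rewrite divr_ge0// ltW.
have -> : a / b * (n'%:R * b) = n'%:R * a by field; rewrite gt_eqF.
lra.
Unshelve. all: by end_near. Qed.

End LogarithmicGrowth.

(** * The global growth dimensions *)

Local Open Scope ring_scope.

Theorem theorem8 (R : realType) (X : sgraph) (F : set X) (psi : X -> reduced F)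
    (nu mu : nat) :
  connected_graph X -> locally_finite X -> infinite_set [set: X] ->
  homogeneously_self_similar psi -> bounded_geometry X ->
  length_scaling F nu -> volume_scaling psi mu ->
  lower_growth_dim R X = (ln (mu%:R : R) / ln (nu%:R : R))%:E /\
  upper_growth_dim R X = (ln (mu%:R : R) / ln (nu%:R : R))%:E.
Proof.
move=> X_conn X_lf _ X_hss X_bg X_nu X_mu.
have [c [B [c0 B0 lo hi]]] := ball_arcs_growth X_conn X_hss X_nu X_mu X_lf X_bg.
have nu1 := length_scaling_gt1 X_conn X_hss X_nu.
have mu0 := volume_scaling_gt0 X_conn X_hss X_nu X_mu.
(* One vertex suffices to bound the infimum from above and the supremum from below. *)
have [_ [x0 _]] := X_nu.
have vol_lo n (x : X) r : (c * nu ^ n <= r)%N ->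
    ((mu ^ n)%N%:R%:E <= vol R (gball x r))%E.
  by move=> nr; rewrite (volE X_conn X_lf) lee_fin ler_nat; apply: lo.
have vol_hi n (x : X) r : (r <= nu ^ n)%N ->
    (vol R (gball x r) <= (B * mu ^ n)%N%:R%:E)%E.
  by move=> rn; rewrite (volE X_conn X_lf) lee_fin ler_nat; apply: hi.
(* The volume bounds hold with the same constants at every centre, so they pass to [inf_vol] and
   [sup_vol]; both quotients converge, and their lower and upper limits equal the limit. *)
split.
  rewrite /lower_growth_dim.
  rewrite (cvg_limn_einf_sup (growth_exponent_cvg mu0 nu1 c0 B0 _ _)).1//.
    by move=> n r nr; apply/ereal_infP => _ [x _ <-]; apply: vol_lo.
  move=> n r rn; apply: le_trans (vol_hi n x0 r rn).
  by apply: ereal_inf_lbound; exists x0.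
rewrite /upper_growth_dim.
rewrite (cvg_limn_einf_sup (growth_exponent_cvg mu0 nu1 c0 B0 _ _)).2//.
  move=> n r nr; apply: le_trans (vol_lo n x0 r nr) _.
  by apply: ereal_sup_ubound; exists x0.
by move=> n r rn; apply: ge_ereal_sup => _ [x _ <-]; apply: vol_hi.
Qed.
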